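(* Let $F\ge 1$ and $N\ge 1$ be integers and let $e_{k,n}\in\{-1,+1\}$ for $1\le k\le F$, $1\le n\le N$. Let $\mathcal{F}$ be the family of binary sequences $(e_{k,1},\ldots,e_{k,N})\in\{-1,+1\}^N$, $k=1,\ldots,F$, and let $\overline{\mathcal{F}}$ be its dual family of binary sequences $(e_{1,n},e_{2,n},\ldots,e_{F,n})\in\{-1,+1\}^F$, $n=1,\ldots,N$. Then $$C(\mathcal{F})\ \ge\ \left\lceil \log_2 F-\log_2\max_{1\le i\le \log_2 F}\Phi_i(\overline{\mathcal{F}})\right\rceil-1,$$ where $\log_2$ denotes the binary logarithm.
   Context: The $f$-complexity $C(\mathcal{G})$ of a family $\mathcal{G}$ of binary sequences of length $L$ (elements of $\{-1,+1\}^L$) is the greatest integer $j\ge 0$ such that for any indices $1\le t_1<t_2<\cdots<t_j\le L$ and any signs $\epsilon_1,\ldots,\epsilon_j\in\{-1,+1\}$ there is a sequence $(g_1,\ldots,g_L)\in\mathcal{G}$ with $g_{t_1}=\epsilon_1,\ldots,g_{t_j}=\epsilon_j$. The cross-correlation measure of order $\ell$ of a family $\mathcal{G}$ of binary sequences $G_i=(g_{i,1},\ldots,g_{i,L})\in\{-1,+1\}^L$, $i=1,\ldots,K$, is $$\Phi_\ell(\mathcal{G})=\max_{M,D,I}\left|\sum_{n=1}^{M} g_{i_1,n+d_1}\cdots g_{i_\ell,n+d_\ell}\right|,$$ where the maximum is over positive integers $M$, over $\ell$-tuples $D=(d_1,\ldots,d_\ell)$ of integers with $0\le d_1\le d_2\le\cdots\le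 d_\ell<M+d_\ell\le L$ and $d_a\ne d_b$ whenever $a\ne b$ and $G_{i_a}=G_{i_b}$, and over $\ell$-tuples $I=(i_1,\ldots,i_\ell)\in\{1,\ldots,K\}^\ell$.
   Formalization: The sequences of the dual family are assumed pairwise distinct and F ≤ 2^N (both hold if the two families consist of distinct sequences); for arbitrary signs the inequality fails, e.g. N = 1, F = 4096 with one column of small autocorrelation. *)

(* Defs.v *)
(* Mathematical Components / MathComp-Analysis *)
From HB Require Import structures.
From mathcomp Require Import all_boot all_order all_algebra.
From mathcomp Require Import reals exp.

Set Implicit Arguments.
Unset Strict Implicit.
Unset Printing Implicit Defensive.

Import Order.TTheory GRing.Theory Num.Theory.
Local Open Scope ring_scope.

(* Indices start at 0 throughout: the n-th term (1 <= n <= L) of a sequence of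
   length L sits at position n-1, and a family of K sequences is indexed by
   'I_K. *)

(* The two-element finite type {1, -1} of integers. *)
Notation pm1 := (seq_sub [:: 1%:Z; -1%:Z]).

Notation binseq L := {ffun 'I_L -> pm1}.

Definition increasing (j L : nat) (t : {ffun 'I_j -> 'I_L}) : bool :=
  [forall a : 'I_j, forall b : 'I_j, (a < b)%N ==> (t a < t b)%N].

Definition realizes_all (K L : nat) (G : 'I_K -> binseq L) (j : nat) : bool :=
  [forall t : {ffun 'I_j -> 'I_L}, forall eps : {ffun 'I_j -> pm1},
    increasing t ==> [exists i, forall a, G i (t a) == eps a]].

(* Only j <= L is considered: for j > L there is no choice of indices, so
   realizes_all holds vacuously and no greatest j would exist. *)
Definition fcomplexity (K L : nat) (G : 'I_K -> binseq L) : nat :=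
  \max_(j < L.+1 | realizes_all G j) j.

(* Value at position p; the default 0 for p >= L is never reached in a
   correlation sum with admissible lags. *)
Definition entry (L : nat) (g : binseq L) (p : nat) : int :=
  if insub p is Some q then val (g q) else 0.

Definition correlation (K L l : nat) (G : 'I_K -> binseq L) (M : nat)
    (D : {ffun 'I_l -> 'I_L}) (I : {ffun 'I_l -> 'I_K}) : int :=
  \sum_(n < M) \prod_(a < l) entry (G (I a)) (n + D a)%N.

(* Since D is nondecreasing, the second clause says M + d_l <= L. *)
Definition admissible (K L l : nat) (G : 'I_K -> binseq L) (M : nat)
    (D : {ffun 'I_l -> 'I_L}) (I : {ffun 'I_l -> 'I_K}) : bool :=
  [&& (0 < M)%N,
      [forall a : 'I_l, (M + D a <= L)%N],
      [forall a : 'I_l, forall b : 'I_l, (a <= b)%N ==> (D a <= D b)%N]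
    & [forall a : 'I_l, forall b : 'I_l,
         (a != b) && (G (I a) == G (I b)) ==> (D a != D b)]].

(* Admissibility forces M <= L and d_a < L, so the maximum ranges over a finite
   type. *)
Definition cross_correlation (K L l : nat) (G : 'I_K -> binseq L) : nat :=
  \max_(M < L.+1) \max_(D : {ffun 'I_l -> 'I_L})
    \max_(I : {ffun 'I_l -> 'I_K} | admissible G M D I)
      `|correlation G M D I|%N.

Definition primal_family (F N : nat) (e : 'I_F -> 'I_N -> pm1) (k : 'I_F) : binseq N :=
  [ffun n => e k n].

Definition dual_family (F N : nat) (e : 'I_F -> 'I_N -> pm1) (n : 'I_N) :
    binseq F :=
  [ffun k => e k n].

Definition log2 (R : realType) (x : R) : R := ln x / ln 2.

(* As log2 F <= F, the bound i < F.+1 does not restrict the range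
   1 <= i <= log2 F.  For F = 1 the range is empty and the maximum is
   0, whose log2 is 0. *)
Definition max_cross_correlation (R : realType) (F N : nat)
    (G : 'I_N -> binseq F) : nat :=
  \max_(1 <= i < F.+1 | i%:R <= log2 (F%:R : R)) cross_correlation i G.

(* Main.v *)
(* Fix indices t_1 < ... < t_j and signs eps_a.  The sum over k of
   prod_a (1 + eps_a e_{k,t_a}) is 2^j times the number of k realizing the signs.
   Expanding the product, the empty set contributes F, and every nonempty set S of
   indices contributes, up to sign, a correlation of order |S| of the dual family
   with all lags 0 and M = F.  So the number is positive once
   F > (2^j - 1) max_i Phi_i, which holds for j < log2 F - log2 max_i Phi_i. *)
Require Import Defs.
From HB Require Import structures.
From mathcomp Require Import all_boot all_order all_algebra.
From mathcomp Require Import reals exp.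

Set Implicit Arguments.
Unset Strict Implicit.
Unset Printing Implicit Defensive.

Import Order.TTheory GRing.Theory Num.Theory.
Local Open Scope ring_scope.

Lemma pm1_cases (x : pm1) : val x = 1 \/ val x = -1.
Proof. by have := valP x; rewrite !inE => /orP[] /eqP; [left|right]. Qed.

Lemma pm1_neq (x y : pm1) : x != y -> 1 + val x * val y = 0.
Proof.
rewrite -val_eqE.
by case: (pm1_cases x) (pm1_cases y) => -> [] ->; rewrite ?eqxx.
Qed.

Lemma norm_pm1 (x : pm1) : `|val x| = 1.
Proof. by case: (pm1_cases x) => ->. Qed.

Lemma entryE (L : nat) (g : binseq L) (q : 'I_L) : entry g q = val (g q).
Proof. by rewrite /entry valK. Qed.

Lemma leq_cross_correlation (K L l : nat) (G : 'I_K -> binseq L) (M : nat)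
    (D : {ffun 'I_l -> 'I_L}) (I : {ffun 'I_l -> 'I_K}) :
  (M <= L)%N -> admissible G M D I ->
  (`|correlation G M D I| <= cross_correlation l G)%N.
Proof.
move=> leML admDI; rewrite -ltnS in leML.
apply: leq_trans (leq_bigmax (Ordinal leML)).
apply: leq_trans (leq_bigmax D) => /=.
exact: (leq_bigmax_cond (F := fun I => absz (correlation G M D I))) admDI.
Qed.

(** Take all lags 0 and [M = L]. Equal lags are admissible here because [enum_val] and [G] are
    injective, so no sequence is chosen twice. *)
Lemma leq_cross_correlation_full (K L : nat) (G : 'I_K -> binseq L)
    (S : {set 'I_K}) :
  (0 < L)%N -> injective G ->
  (`|(\sum_(k < L) \prod_(n in S) val (G n k))%R| <= cross_correlation #|S| G)%N.
Proof.
move=> L_gt0 G_inj.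
pose D : {ffun 'I_#|S| -> 'I_L} := [ffun=> Ordinal L_gt0].
pose I : {ffun 'I_#|S| -> 'I_K} := [ffun a => enum_val a].
have admDI : admissible G L D I.
  apply/and4P; split=> //.
  - by apply/forallP => a; rewrite ffunE addn0.
  - by apply/'forall_forallP => a b; rewrite !ffunE leqnn implybT.
  apply/'forall_forallP => a b; apply/implyP => /andP[neq_ab /eqP/G_inj].
  by rewrite !ffunE => /enum_val_inj eq_ab; rewrite eq_ab eqxx in neq_ab.
have := leq_cross_correlation (leqnn L) admDI; congr (absz _ <= _)%N.
apply: eq_bigr => k _; rewrite [RHS]big_enum_val /=.
by apply: eq_bigr => a _; rewrite !ffunE addn0 entryE.
Qed.

Lemma increasing_inj (j L : nat) (t : {ffun 'I_j -> 'I_L}) :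
  increasing t -> injective t.
Proof.
move=> /'forall_forallP incr_t a b eq_t; apply: val_inj.
by case: (ltngtP a b) => // lt_ab; have := implyP (incr_t _ _) lt_ab;
  rewrite eq_t ltnn.
Qed.

Lemma realizes_all_primal (F N : nat) (e : 'I_F -> 'I_N -> pm1) (j P : nat) :
  (0 < F)%N -> injective (dual_family e) ->
  (forall i, (0 < i <= j)%N -> (cross_correlation i (dual_family e) <= P)%N) ->
  (P * (2 ^ j).-1 < F)%N -> realizes_all (primal_family e) j.
Proof.
move=> F_gt0 dual_inj leP ltF.
apply/'forall_forallP => t eps; apply/implyP => /increasing_inj t_inj.
apply: contraLR ltF => /existsPn no_real; rewrite -leqNgt.
pose T (S : {set 'I_j}) : int :=
  \sum_(k < F) \prod_(a in S) (val (eps a) * val (e k (t a))).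
(* If no k realizes [eps], each k has a mismatched position, whose factor -1 + 1 kills the whole
   product before expansion. *)
have sumT0 : \sum_S T S = 0.
  rewrite exchange_big big1 //= => k _.
  have : \prod_a (val (eps a) * val (e k (t a)) + 1) = 0.
    have /forallPn[a] := no_real k; rewrite ffunE eq_sym => neq_a.
    by rewrite (bigD1 a) //= addrC pm1_neq ?mul0r.
  by rewrite bigA_distr /=; apply: etrans; apply: eq_big => [S|S _];
    rewrite ?inE // big_mkcond.
have T0 : T set0 = F%:Z.
  rewrite /T; under eq_bigr do rewrite big_set0.
  by rewrite sumr_const card_ord natz.
have leT (S : {set 'I_j}) : S != set0 -> `|T S| <= P%:Z.
  rewrite -card_gt0 => S_gt0.
  (* The signs factor out with absolute value 1. Since [t] is injective, [t @: S] has as many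
     elements as [S], so the order is at most [j]. *)
  have -> : T S = (\prod_(a in S) val (eps a))
                  * \sum_(k < F) \prod_(n in t @: S) val (dual_family e n k).
    rewrite mulr_sumr; apply: eq_bigr => k _.
    rewrite big_split big_imset /=; last exact: in2W.
    by congr (_ * _); apply: eq_bigr => a _; rewrite ffunE.
  rewrite normrM normr_prod big1 ?mul1r => [|a _]; last exact: norm_pm1.
  rewrite -abszE lez_nat.
  apply: leq_trans (leq_cross_correlation_full _ F_gt0 dual_inj) _.
  by rewrite card_imset // leP // S_gt0 -[leqRHS]card_ord max_card.
(* F = [T set0] is minus the sum of the other 2^j - 1 terms, each at most [P] in absolute value. *)
rewrite -lez_nat -T0; move/eqP: sumT0; rewrite (bigD1 set0) //= addr_eq0.
move=> /eqP ->; apply: le_trans (ler_norm _) _; rewrite normrN.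
apply: le_trans (ler_norm_sum _ _ _) _.
apply: le_trans (ler_sum _ leT) _.
rewrite sumr_const -mulr_natr natz -PoszM lez_nat leq_mul2l.
rewrite (cardC1 (set0 : {set 'I_j})) -cardsT -powersetT card_powerset.
by rewrite cardsT card_ord leqnn orbT.
Qed.

Lemma ltr_log2 (R : realType) (j p n : nat) :
  (0 < p)%N -> (0 < n)%N ->
  (j%:R < log2 (n%:R : R) - log2 (p%:R : R)) = (2 ^ j * p < n)%N.
Proof.
move=> p_gt0 n_gt0.
have ln2_gt0 : 0 < ln (2 : R) by rewrite ln_gt0 ?ltr1n.
rewrite ltrBrDr /log2 -(ltr_pM2r ln2_gt0) mulrDl !divfK ?gt_eqF //.
rewrite mulr_natl -lnXn ?ltr0n // -lnM ?posrE ?exprn_gt0 ?ltr0n //.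
by rewrite ltr_ln ?posrE ?mulr_gt0 ?exprn_gt0 ?ltr0n // -natrX -natrM ltr_nat.
Qed.

(* A family consists of pairwise distinct sequences.  For the dual family this
   is [dual_inj]; for the family itself only the consequence F <= 2 ^ N is
   needed.  Without either of these the inequality fails. *)
Theorem theorem2p1 (R : realType) (F N : nat) (e : 'I_F -> 'I_N -> pm1)
    (F_gt0 : (0 < F)%N) (N_gt0 : (0 < N)%N)
    (F_le : (F <= 2 ^ N)%N) (dual_inj : injective (dual_family e)) :
  Num.ceil (log2 (F%:R : R)
            - log2 ((max_cross_correlation R (dual_family e))%:R : R)) - 1
  <= (fcomplexity (primal_family e))%:Z.
Proof.
set Phi := max_cross_correlation R (dual_family e).
(* [Phi] is 0 when F = 1; raising it to 1 leaves its [log2] unchanged and makes [ltr_log2]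
   applicable. *)
pose P := maxn Phi 1.
have P_gt0 : (0 < P)%N by rewrite leq_max orbT.
(* [ln 0 = 0] *)
have -> : log2 (Phi%:R : R) = log2 (P%:R : R).
  rewrite /P; case: (Phi) => [|n]; last by rewrite (maxn_idPl _).
  by rewrite /log2 ln1 ln0.
set x := _ - log2 _.
have [/le_trans|j_gt0] := lerP (Num.ceil x - 1) 0; first exact.
(* The claimed bound is now a natural number [j] strictly below [x], which means 2^j P < F. *)
have := ceilB1_lt x; case: (Num.ceil x - 1) j_gt0 => // j _; rewrite -pmulrn.
rewrite ltr_log2 // => ltF.
have lt2jF : (2 ^ j < F)%N by apply: leq_ltn_trans ltF; rewrite leq_pmulr.
(* From 2^j < F <= 2^N, [j] lies in the range of the maximum defining [fcomplexity]. *)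
have lejN : (j < N.+1)%N.
  by rewrite ltnS ltnW // -(ltn_exp2l _ _ (ltnSn 1)) (leq_trans lt2jF).
rewrite lez_nat.
apply: (leq_bigmax_cond (F := fun j : 'I_N.+1 => nat_of_ord j) (Ordinal lejN)).
apply: (realizes_all_primal (P := P)) => //= [i /andP[i_gt0 leij]|]; last first.
  by apply: leq_ltn_trans ltF; rewrite mulnC leq_mul2r leq_pred orbT.
(* Hence i < log2 F, so order [i] is among those that [Phi] bounds. *)
have lt2iF : (2 ^ i < F)%N by apply: leq_ltn_trans lt2jF; rewrite leq_pexp2l.
rewrite leq_max; apply/orP; left.
rewrite /Phi /max_cross_correlation.
apply: (leq_bigmax_seq (F := fun i => cross_correlation i (dual_family e))).
  by rewrite mem_index_iota i_gt0 ltnS ltnW // (ltn_trans (ltn_expl i (ltnSn 1))).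
have := @ltr_log2 R i 1 F isT F_gt0.
by rewrite muln1 lt2iF /log2 ln1 mul0r subr0 => /ltW.
Qed.
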